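(* Suppose Assumption (N) holds with $p_i=2$ for all $i$. Let $(f^n)_n$ in $Y$ and $f^\dagger\in Y$ be such that $\delta_i^n:=\|f_i^\dagger-f_i^n\|_{Y_i}\to0$ as $n\to\infty$ for all $i$, and assume that $$\delta_i^n\sim(\delta^n)^{\mu_i}$$ with $(0,\infty)\ni\delta^n\to0$, $\mu_i\ge1$ and $\mu_{i_0}=1$ for some $i_0$. Let $\lambda^n\in(0,\infty)^N$ be such that for all $i$ $$\lambda_i^n\sim(\delta_i^n)^{-(2-1/\mu_i)}.$$ Let $(u^n)_n$ be a sequence of solutions to $\min_{u\in\operatorname{dom}(T)}J_{\lambda^n}(u,f^n)$ and $u^\dagger$ an $R$-minimizing solution of $Tu=f^\dagger$. Then there is $C>0$ such that for all but finitely many $n$ $$R(u^n)\le R(u^\dagger)+C\delta^n.$$ Assume further that there exist $\xi\in\partial R(u^\dagger)$ and constants $0<\beta_1<1$, $0<\beta_2$ such that $$-\langle\xi,u-u^\dagger\rangle\le\beta_1D_R^\xi(u,u^\dagger)+\beta_2\sum_{i=1}^N\|T_iu-T_iu^\dagger\|_{Y_i}$$ for all $u$ satisfying $R(u)+\sum_{i=1}^N\|T_iu-f_i^\dagger\|_{Y_i}^2\le R(u^\dagger)+\epsilon$ for some $\epsilon>0$. Then, for any $j$, $$D_R^\xi(u^n,u^\dagger)=O(\delta^n),\qquad\|T_ju^n-f_j^n\|_{Y_j}^2=O\big((\delta^n)^{2\mu_j}\big).$$ This parameter choice is optimal for the upper bounds $$B^n(\lambda)=\sum_{i=1}^N\big((\lambda_i^n)^{-1}+\lambda_i^n(\delta_i^n)^2+\delta_i^n\big)\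 \text{ for }D_R^\xi(u^n,u^\dagger),\qquad(\lambda_j^n)^{-1}B^n(\lambda)\ \text{ for }\|T_ju^n-f_j^n\|_{Y_j}^2$$ (up to constants) in the sense that they cannot be improved by choosing $\tilde\lambda_i^n=(\delta_i^n)^{-(2-\epsilon_i)}$ with $\epsilon_i\in(0,2)$: for any such choice there is $c>0$ with $B^n(\tilde\lambda)\ge c\,\delta^n$ and $(\tilde\lambda_j^n)^{-1}B^n(\tilde\lambda)\ge c\,(\delta^n)^{2\mu_j}$ for all $j$ and all $n$.
   Context: Setting. Let $(X,\|\cdot\|_X)$ be a Banach space and $R\colon X\to[0,\infty]$. For $i=1,\dots,N$ let $(Y_i,\|\cdot\|_{Y_i})$ be a normed space and $T_i\colon\operatorname{dom}(T_i)\subset X\to Y_i$ an operator. Put $\operatorname{dom}(T)=\bigcap_{i=1}^N\operatorname{dom}(T_i)$, $Y=Y_1\times\cdots\times Y_N$ and $Tu=(T_1u,\dots,T_Nu)$; it is assumed that $\operatorname{dom}(T)$ contains a point where $R$ is finite. For $u\in\operatorname{dom}(T)$, $f\in Y$ and $\lambda\in(0,\infty)^N$ let $$J_\lambda(u,f)=R(u)+\sum_{i=1}^N\lambda_i\|T_iu-f_i\|_{Y_i}^2.$$ An $R$-minimizing solution of $Tu=f^\dagger$ is a minimizer of $R$ over $\{u\in\operatorname{dom}(T):Tu=f^\dagger\}$ at which $R$ is finite. In expressions involving $T_iu$, $u$ ranges over $\operatorname{dom}(T)$. $\xi\in\partial R(u)\subset X^*$ means $R(u)<\infty$ and $R(v)\ge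 R(u)+\langle\xi,v-u\rangle$ for all $v\in X$; the Bregman distance is $D_R^\xi(v,u)=R(v)-R(u)-\langle\xi,v-u\rangle$. For sequences, $x^n\sim y^n$ means there are $c,C>0$ with $cy^n\le x^n\le Cy^n$ for all $n$; $x^n=O(y^n)$ means there is $C>0$ with $x^n\le Cy^n$ for all sufficiently large $n$. Let $\tau_X$ be a Hausdorff topology on $X$ and $\tau_{Y_i}$ a Hausdorff topology on $Y_i$. Assumption (N): (1) Each $\|\cdot\|_{Y_i}$ is sequentially lower semi-continuous w.r.t. $\tau_{Y_i}$, and addition and scalar multiplication are continuous in the topology $\tau_{Y_i}$. (2) $R$ is lower semi-continuous w.r.t. $\tau_X$. (3) Each $T_i$ is continuous from $(X,\tau_X)$ (on $\operatorname{dom}(T_i)$) to $(Y_i,\tau_{Y_i})$ and $\operatorname{dom}(T_i)$ is closed w.r.t. convergence in $\tau_X$. (4) For any $\lambda\in(0,\infty)^N$, $f\in Y$ and any sequence $(u^n)_n$: if $J_\lambda(u^n,f)<c$ for all $n$ and some constant $c$, then $(u^n)_n$ admits a $\tau_X$-convergent subsequence. *)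

(* Defs.v *)
From HB Require Import structures.
From mathcomp Require Import all_boot all_order all_algebra.
From mathcomp Require Import all_classical all_reals all_analysis.
Set Implicit Arguments.
Unset Strict Implicit.
Unset Printing Implicit Defensive.
Import Order.TTheory GRing.Theory Num.Theory.
Import numFieldNormedType.Exports.
Local Open Scope classical_set_scope.
Local Open Scope ring_scope.

(* A topology on a type [T] that already carries a norm topology is a structure
   [tau : topology_on T]; [top_space tau] is the topological space (T, tau). The
   predicates below take the space as an explicit argument, so that the norm
   topology of the underlying type is never inferred in its place. *)
Definition topology_on (T : Type) := Topological.axioms_ T.
Definition top_space (T : Type) (tau : topology_on T) : topologicalType :=
  Topological.Pack tau.

Section Topologies.
Variables S T : topologicalType.

Definition seq_cvg (u : nat -> T) (x : T) : Prop := u @ \oo --> x.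

Definition seq_closed (D : set T) : Prop :=
  forall (u : nat -> T) (x : T), (forall n, D (u n)) -> seq_cvg u x -> D x.

Definition seq_lsc (R : realType) (f : T -> \bar R) : Prop :=
  forall (u : nat -> T) (x : T), seq_cvg u x -> (f x <= limn_einf (f \o u))%E.

Definition has_cvg_subseq (u : nat -> T) : Prop :=
  exists2 phi : nat -> nat, {homo phi : m n / (m < n)%N}
    & exists x : T, seq_cvg (u \o phi) x.

Definition continuous_on (D : set S) (f : S -> T) : Prop :=
  {within D, continuous f}.

Definition continuous_add (add : T -> T -> T) : Prop :=
  continuous (fun z : T * T => add z.1 z.2).

Definition continuous_scale (R : realType) (scale : R -> T -> T) : Prop :=
  continuous (fun z : R^o * T => scale z.1 z.2).

End Topologies.

Section Sequences.
Variable R : realType.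

Definition sim (x y : nat -> R) : Prop :=
  exists c C : R, [/\ 0 < c, 0 < C & forall n, c * y n <= x n <= C * y n].

(* One-sided: no absolute value is taken on the left-hand side. *)
Definition isO (x : nat -> \bar R) (y : nat -> R) : Prop :=
  exists2 C : R, 0 < C & \forall n \near \oo, (x n <= (C * y n)%:E)%E.

End Sequences.

Section Subdifferential.
Variables (R : realType) (X : normedModType R) (Reg : X -> \bar R).

Definition subgradient (u : X) (xi : {linear X -> R^o}) : Prop :=
  [/\ continuous xi, (Reg u < +oo)%E
    & forall v : X, (Reg u + (xi (v - u))%:E <= Reg v)%E].

(* Only meaningful when [Reg u] is finite, as it is if [xi] is a subgradient
   at [u]. *)
Definition bregman (xi : {linear X -> R^o}) (v u : X) : \bar R :=
  (Reg v - Reg u - (xi (v - u))%:E)%E.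

End Subdifferential.

(* The operator [T i] with domain [D i] is a total function whose values outside
   [D i] play no role. *)
Section Tikhonov.
Variables (R : realType) (X : normedModType R) (N : nat).
Variables (Y : 'I_N -> normedModType R) (Reg : X -> \bar R).
Variables (D : 'I_N -> set X) (T : forall i, X -> Y i).
Implicit Types (lam : 'I_N -> R) (f : forall i, Y i) (u v : X).

Definition domT : set X := [set u | forall i, D i u].

Definition J lam f u : \bar R :=
  (Reg u + (\sum_(i < N) lam i * `|T i u - f i| ^+ 2)%:E)%E.

Definition J_solution lam f u : Prop :=
  domT u /\ forall v, domT v -> (J lam f u <= J lam f v)%E.

Definition R_minimizing_solution f u : Prop :=
  [/\ domT u, forall i, T i u = f i, (Reg u < +oo)%E
    & forall v, domT v -> (forall i, T i v = f i) -> (Reg u <= Reg v)%E].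

Record assumptionN (tauX : topology_on X)
    (tauY : forall i, topology_on (Y i)) : Prop := AssumptionN {
  norm_seq_lsc : forall i,
    @seq_lsc (top_space (tauY i)) R (fun y : Y i => `|y|%:E) ;
  add_cont : forall i,
    @continuous_add (top_space (tauY i)) (fun y z : Y i => y + z) ;
  scale_cont : forall i,
    @continuous_scale (top_space (tauY i)) R (fun a (y : Y i) => a *: y) ;
  Reg_lsc : @lower_semicontinuous (top_space tauX) R Reg ;
  T_cont : forall i,
    @continuous_on (top_space tauX) (top_space (tauY i)) (D i) (T i) ;
  D_closed : forall i, @seq_closed (top_space tauX) (D i) ;
  J_compact : forall lam f (u : nat -> X) (c : R),
    (forall i, 0 < lam i) -> (forall n, domT (u n)) ->
    (forall n, (J lam f (u n) < c%:E)%E) ->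
    @has_cvg_subseq (top_space tauX) u
}.

Definition source_condition (fdag : forall i, Y i) (udag : X)
    (xi : {linear X -> R^o}) (beta1 beta2 : R) : Prop :=
  exists2 eps : R, 0 < eps & forall u, domT u ->
    (Reg u + (\sum_(i < N) `|T i u - fdag i| ^+ 2)%:E <= Reg udag + eps%:E)%E ->
    ((- xi (u - udag))%:E <= beta1%:E * bregman Reg xi u udag
       + (beta2 * \sum_(i < N) `|T i u - T i udag|)%:E)%E.

Definition noise (fdag : forall i, Y i) (f : nat -> forall i, Y i)
  (n : nat) (i : 'I_N) : R := `|fdag i - f n i|.

(* B^n(lambda); the second argument is delta_i^n. *)
Definition bound (lam del : nat -> 'I_N -> R) (n : nat) : R :=
  \sum_(i < N) ((lam n i)^-1 + lam n i * del n i ^+ 2 + del n i).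

End Tikhonov.

(* Main.v *)
Require Import Defs.
From HB Require Import structures.
From mathcomp Require Import all_boot all_order all_algebra.
From mathcomp Require Import all_classical all_reals all_analysis.
From mathcomp Require Import lra ring.
Set Implicit Arguments.
Unset Strict Implicit.
Unset Printing Implicit Defensive.
Import Order.TTheory GRing.Theory Num.Theory.
Import numFieldNormedType.Exports.
Local Open Scope classical_set_scope.
Local Open Scope ring_scope.

(** The minimality of [u n], tested against [udag], gives the energy inequality
    [Reg (u n) + \sum_i lam_i |T_i (u n) - f_i|^2
       <= Reg udag + \sum_i lam_i delta_i^2]
    ([J_solution_energy_le]). Its right-hand side already yields the bound on
    [Reg (u n)], since the choice [lam_i ~ delta_i^-(2 - 1/mu_i)] makes each
    term [lam_i delta_i^2 ~ delta_i^(1/mu_i)] of order [delta].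

    For the rates, the source condition bounds the linear part of the Bregman
    distance by [beta1] times that distance, which is absorbed on the left as
    [beta1 < 1], plus [beta2 \sum_i |T_i (u n) - T_i udag|]. After splitting off
    [delta_i] by the triangle inequality, the residual enters linearly, and
    Young's inequality trades it for [beta2^2 / (2 lam_i)] and half of the
    quadratic penalty on the left. What remains is a multiple of the bound [B^n]
    ([source_condition_estimate]).

    The source condition may be used at [u n] for a direct reason: [B^n] tends
    to 0 and dominates both [lam_i^-1] and [\sum_i lam_i delta_i^2], so
    eventually [lam_i >= 2], and then [|a + b|^2 <= 2 |a|^2 + 2 |b|^2] lets the
    energy inequality absorb the unweighted residuals.

    With the exponents prescribed for [lam], every summand of [B^n] is
    [O(delta)] because [mu_i >= 1] ([bound_dominated]). Conversely, for any
    parameters at all, [B^n] contains [delta_i0], which is of order [delta] when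
    [mu_i0 = 1], and [lam_j^-1 B^n] contains [delta_j^2], which is of order
    [delta^(2 mu_j)]; this is the optimality claim. *)

(** * Domination of real sequences *)

Section Domination.
Variable R : realType.
Implicit Types (x y z : nat -> R).

(** The bound is asked for every index, not only eventually: the optimality claim
    and the power laws have this form, and it composes without filters. *)
Definition dominated x y : Prop := exists2 C : R, 0 < C & forall n, x n <= C * y n.

Lemma dominated_refl x : dominated x x.
Proof. by exists 1 => // n; rewrite mul1r. Qed.

Lemma dominated_trans y x z : dominated x y -> dominated y z -> dominated x z.
Proof.
move=> [C C0 xy] [E E0 yz]; exists (C * E); first exact: mulr_gt0.
by move=> n; rewrite (le_trans (xy n))// -mulrA ler_pM2l.
Qed.

Lemma dominatedM x1 x2 y1 y2 :
  (forall n, 0 <= x1 n) -> (forall n, 0 <= x2 n) ->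
  dominated x1 y1 -> dominated x2 y2 ->
  dominated (fun n => x1 n * x2 n) (fun n => y1 n * y2 n).
Proof.
move=> x10 x20 [C C0 xy1] [E E0 xy2]; exists (C * E); first exact: mulr_gt0.
by move=> n; rewrite mulrACA; exact: ler_pM.
Qed.

Lemma dominatedD x1 x2 y :
  dominated x1 y -> dominated x2 y -> dominated (fun n => x1 n + x2 n) y.
Proof.
move=> [C C0 xy1] [E E0 xy2]; exists (C + E); first exact: addr_gt0.
by move=> n; rewrite mulrDl; exact: lerD.
Qed.

Lemma dominated_sum (I : Type) (r : seq I) (x : nat -> I -> R) y :
  (forall n, 0 <= y n) -> (forall i, dominated (fun n => x n i) y) ->
  dominated (fun n => \sum_(i <- r) x n i) y.
Proof.
move=> y0 xy; elim: r => [|i r IHr].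
  by exists 1 => // n; rewrite big_nil mul1r.
have [C C0 CP] := dominatedD (xy i) IHr.
by exists C => // n; rewrite big_cons.
Qed.

Lemma dominated_powR x y (a : R) :
  (forall n, 0 <= x n) -> (forall n, 0 <= y n) -> 0 <= a ->
  dominated x y -> dominated (fun n => x n `^ a) (fun n => y n `^ a).
Proof.
move=> x0 y0 a0 [C C0 xy]; exists (C `^ a); first exact: powR_gt0.
move=> n; rewrite -powRM ?(ltW C0)//.
by apply: ge0_ler_powR; rewrite ?nnegrE// mulr_ge0// ltW.
Qed.

Lemma cvg_dominated1 x (l : R) : x @ \oo --> l -> dominated x (fun=> 1).
Proof.
move=> xl; have /cvg_seq_bounded : cvgn x by apply/cvg_ex; exists l.
move=> /pinfty_ex_gt0[M M_gt0 Mx]; exists M => // n.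
by rewrite mulr1 (le_trans (ler_norm _))//; exact: Mx.
Qed.

(** Raising a bounded sequence to a larger power cannot increase its order. *)
Lemma dominated_powR_ge1 x (a : R) : (forall n, 0 < x n) ->
  dominated x (fun=> 1) -> 1 <= a -> dominated (fun n => x n `^ a) x.
Proof.
move=> x0 x1 a1.
have /dominated_powR : 0 <= a - 1 by rewrite subr_ge0.
move=> /(_ x (fun=> 1)) /(_ (fun n => ltW (x0 n)) (fun=> ler01) x1) [C C0 CP].
exists C => // n.
have -> : x n `^ a = x n `^ (a - 1) * x n.
  have x_neq0 : x n != 0 by rewrite gt_eqF.
  rewrite powRB; last by rewrite x_neq0 implybT.
  by rewrite powRr1 ?divfK// ltW.
by rewrite ler_pM2r//; have := CP n; rewrite powR1 mulr1.
Qed.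

Lemma dominated_isO x y : dominated x y -> isO (fun n => (x n)%:E) y.
Proof. by move=> [C C0 CP]; exists C => //; apply: nearW => n; rewrite lee_fin. Qed.

Lemma isO_dominated (x : nat -> \bar R) y z :
  isO x y -> dominated y z -> isO x z.
Proof.
move=> [C C0 xy] [E E0 yz]; exists (C * E); first exact: mulr_gt0.
apply: filterS xy => n /le_trans; apply.
by rewrite lee_fin -mulrA ler_pM2l.
Qed.

Lemma dominated_near_le x y (e : R) : 0 < e -> y @ \oo --> (0 : R) ->
  dominated x y -> \forall n \near \oo, x n <= e.
Proof.
move=> e0 y0 [C C0 xy].
have y_le : \forall n \near \oo, y n <= e / C.
  by apply: (cvgr_le 0) => //; exact: divr_gt0.
apply: filterS y_le => n; rewrite ler_pdivlMr// mulrC.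
exact: le_trans.
Qed.

Lemma sim_dominated x y : sim x y -> dominated x y.
Proof. by move=> [c [C [_ C0 xy]]]; exists C => // n; case/andP: (xy n). Qed.

Lemma sim_dominated_sym x y : sim x y -> dominated y x.
Proof.
move=> [c [C [c0 _ xy]]]; exists c^-1; first by rewrite invr_gt0.
by move=> n; rewrite ler_pdivlMl//; case/andP: (xy n).
Qed.

Lemma dominated_inv x y : (forall n, 0 < x n) -> (forall n, 0 < y n) ->
  dominated x y -> dominated (fun n => (y n)^-1) (fun n => (x n)^-1).
Proof.
move=> x0 y0 [C C0 xy]; exists C => // n.
by rewrite ler_pdivlMr// mulrC ler_pdivrMr.
Qed.

End Domination.

(** * Deterministic estimates for a minimizer *)

Section Minimizers.
Variables (R : realType) (X : normedModType R) (N : nat).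
Variables (Y : 'I_N -> normedModType R) (Reg : X -> \bar R).
Variables (D : 'I_N -> set X) (T : forall i, X -> Y i).
Hypothesis Reg_ge0 : forall u, (0 <= Reg u)%E.
Variables (fdag f : forall i, Y i) (lam : 'I_N -> R) (u udag : X).
Hypothesis lam_gt0 : forall i, 0 < lam i.
Hypothesis u_sol : J_solution Reg D T lam f u.
Hypothesis udag_sol : R_minimizing_solution Reg D T fdag udag.

Let del i := `|fdag i - f i|.
Let res i := `|T i u - f i|.

Lemma J_solution_energy_le :
  (Reg u + (\sum_(i < N) lam i * res i ^+ 2)%:E
   <= Reg udag + (\sum_(i < N) lam i * del i ^+ 2)%:E)%E.
Proof.
have [_ /(_ udag)] := u_sol; case: udag_sol => Dudag Tudag _ _ /(_ Dudag).
rewrite /J; congr (_ <= _ + _%:E)%E; apply: eq_bigr => i _.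
by rewrite Tudag.
Qed.

Lemma J_solution_Reg_le :
  (Reg u <= Reg udag + (\sum_(i < N) lam i * del i ^+ 2)%:E)%E.
Proof.
apply: le_trans J_solution_energy_le; rewrite leeDl// lee_fin sumr_ge0// => i _.
by rewrite mulr_ge0 ?sqr_ge0// ltW.
Qed.

Lemma image_dist_le i : `|T i u - fdag i| <= res i + del i.
Proof. by rewrite /res /del (distrC (fdag i)) ler_distD. Qed.

(** Weights of at least 2 pay for the loss in
    [|a + b|^2 <= 2 |a|^2 + 2 |b|^2], so the energy inequality controls the
    unweighted distance to the exact data. *)
Lemma J_solution_sublevel : (forall i, 2 <= lam i) ->
  (Reg u + (\sum_(i < N) `|T i u - fdag i| ^+ 2)%:E
   <= Reg udag + (2 * \sum_(i < N) lam i * del i ^+ 2)%:E)%E.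
Proof.
move=> lam2.
have sq i : `|T i u - fdag i| ^+ 2 <= lam i * res i ^+ 2 + lam i * del i ^+ 2.
  have res0 : 0 <= res i by exact: normr_ge0.
  have del0 : 0 <= del i by exact: normr_ge0.
  have : `|T i u - fdag i| ^+ 2 <= (res i + del i) ^+ 2.
    by rewrite ler_sqr ?nnegrE ?addr_ge0// image_dist_le.
  have : 0 <= (res i - del i) ^+ 2 by exact: sqr_ge0.
  have : 0 <= (lam i - 2) * (res i ^+ 2 + del i ^+ 2).
    by rewrite mulr_ge0 ?subr_ge0// addr_ge0 ?sqr_ge0.
  nra.
have : \sum_(i < N) `|T i u - fdag i| ^+ 2 <=
    \sum_(i < N) lam i * res i ^+ 2 + \sum_(i < N) lam i * del i ^+ 2.
  by rewrite -big_split/=; exact: ler_sum.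
rewrite -lee_fin EFinD => /(leeD2l (Reg u)) /le_trans; apply.
rewrite addeA mulr_natl mulr2n EFinD addeA.
by rewrite leeD2r// J_solution_energy_le.
Qed.

(** Testing the energy inequality against a subgradient and using Young's
    inequality [b r <= lam r^2 / 2 + b^2 / (2 lam)] on the residuals. *)
Lemma source_condition_estimate (xi : {linear X -> R^o}) (b1 b2 : R) :
  subgradient Reg udag xi -> 0 < b2 ->
  ((- xi (u - udag))%:E <= b1%:E * bregman Reg xi u udag
     + (b2 * \sum_(i < N) `|T i u - T i udag|)%:E)%E ->
  exists2 d : R, bregman Reg xi u udag = d%:E &
    0 <= d /\
    (1 - b1) * d + 2^-1 * \sum_(i < N) lam i * res i ^+ 2 <=
    (1 + b2 + b2 ^+ 2) *
      \sum_(i < N) ((lam i)^-1 + lam i * del i ^+ 2 + del i).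
Proof.
move=> [_ Rudag sub] b20.
have := sub u; have := J_solution_energy_le; have := J_solution_Reg_le.
case: udag_sol => _ Tudag _ _; rewrite /bregman.
move: (Reg_ge0 u) (Reg_ge0 udag) Rudag.
case: (Reg udag) => [r| |]//; case: (Reg u) => [s| |]// _ _ _ _.
rewrite -!EFinD !lee_fin => energy subu src.
exists (s - r - xi (u - udag)); first by rewrite !EFinD !EFinN.
split; first lra.
have young : b2 * \sum_(i < N) `|T i u - T i udag|
    + \sum_(i < N) lam i * del i ^+ 2 <=
    2^-1 * \sum_(i < N) lam i * res i ^+ 2 +
    (1 + b2 + b2 ^+ 2) *
      \sum_(i < N) ((lam i)^-1 + lam i * del i ^+ 2 + del i).
  rewrite !mulr_sumr -!big_split/=; apply: ler_sum => i _.
  rewrite Tudag; have := image_dist_le i.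
  have res0 : 0 <= res i by exact: normr_ge0.
  have del0 : 0 <= del i by exact: normr_ge0.
  have l0 := lam_gt0 i; have li0 : 0 < (lam i)^-1 by rewrite invr_gt0.
  (* Young's inequality in the form of a nonnegative square *)
  have sq : 0 <= (lam i)^-1 * (lam i * res i - b2) ^+ 2.
    by rewrite mulr_ge0 ?sqr_ge0// ltW.
  have sqE : (lam i)^-1 * (lam i * res i - b2) ^+ 2 =
      lam i * res i ^+ 2 - 2 * b2 * res i + b2 ^+ 2 * (lam i)^-1.
    by field; rewrite gt_eqF.
  rewrite sqE in sq.
  have ld : 0 <= lam i * del i ^+ 2 by rewrite mulr_ge0 ?sqr_ge0// ltW.
  have p1 : 0 <= b2 * (lam i)^-1 by rewrite mulr_ge0// ltW.
  have p2 : 0 <= b2 ^+ 2 * (lam i)^-1 by rewrite mulr_ge0 ?sqr_ge0// ltW.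
  have p3 : 0 <= b2 * (lam i * del i ^+ 2) by rewrite mulr_ge0// ltW.
  have p4 : 0 <= b2 ^+ 2 * (lam i * del i ^+ 2) by rewrite mulr_ge0 ?sqr_ge0.
  have p5 : 0 <= b2 ^+ 2 * del i by rewrite mulr_ge0 ?sqr_ge0.
  rewrite -(ler_pM2l b20) => tri.
  move: tri sq ld p1 p2 p3 p4 p5.
  move: (lam i * del i ^+ 2) (lam i * res i ^+ 2) => A E.
  nra.
lra.
Qed.

End Minimizers.

(** * The bound B^n under the a priori choice of parameters *)

Lemma bound_ge_term (R : realType) (N : nat) (lam del : nat -> 'I_N -> R) n i :
  (forall i, 0 < lam n i) -> (forall i, 0 <= del n i) ->
  (lam n i)^-1 + lam n i * del n i ^+ 2 + del n i <= bound lam del n.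
Proof.
move=> l0 d0; rewrite /bound (bigD1 i)//= lerDl sumr_ge0// => k _.
by rewrite !addr_ge0// ?mulr_ge0 ?sqr_ge0 ?invr_ge0// ltW.
Qed.

Lemma penalty_le_bound (R : realType) (N : nat) (lam del : nat -> 'I_N -> R) n :
  (forall i, 0 < lam n i) -> (forall i, 0 <= del n i) ->
  \sum_(i < N) lam n i * del n i ^+ 2 <= bound lam del n.
Proof.
move=> l0 d0; apply: ler_sum => i _.
have : 0 <= (lam n i)^-1 by rewrite invr_ge0 ltW.
have := d0 i; lra.
Qed.

Section ParameterChoice.
Variables (R : realType) (N : nat) (lam del : nat -> 'I_N -> R).
Variables (delta : nat -> R) (mu : 'I_N -> R).
Hypothesis delta_gt0 : forall n, 0 < delta n.
Hypothesis mu_ge1 : forall i, 1 <= mu i.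
Hypothesis del_sim : forall i, sim (fun n => del n i) (fun n => delta n `^ mu i).

Lemma sim_powR_gt0 n i : 0 < del n i.
Proof.
have [c [C [c0 _ /(_ n)/andP[+ _]]]] := del_sim i.
by apply: lt_le_trans; rewrite mulr_gt0// powR_gt0.
Qed.

(** Optimality needs only the summand [lam_j del_j^2] of the bound, whose weight
    cancels, so the parameters can be arbitrary. *)
Lemma powR_dominated_residual_bound (l : nat -> 'I_N -> R) j :
  (forall n i, 0 < l n i) ->
  dominated (fun n => delta n `^ (2 * mu j))
            (fun n => (l n j)^-1 * bound l del n).
Proof.
move=> l0; apply: (@dominated_trans _ (fun n => del n j ^+ 2)).
  have := dominatedM (fun n => powR_ge0 (delta n) (mu j))
    (fun n => powR_ge0 (delta n) (mu j))
    (sim_dominated_sym (del_sim j)) (sim_dominated_sym (del_sim j)).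
  move=> [C C0 CP]; exists C => // n; rewrite expr2.
  by rewrite mulrC powRrM -[2]/(2%:R) powR_mulrn ?powR_ge0// expr2; exact: CP.
exists 1 => // n; rewrite mul1r ler_pdivlMl//.
apply: le_trans (bound_ge_term j (l0 n) (fun i => ltW (sim_powR_gt0 n i))).
have := sim_powR_gt0 n j; have : 0 < (l n j)^-1 by rewrite invr_gt0.
lra.
Qed.

Lemma delta_dominated_bound (l : nat -> 'I_N -> R) i0 : mu i0 = 1 ->
  (forall n i, 0 < l n i) -> dominated delta (bound l del).
Proof.
move=> mu1 l0; apply: (@dominated_trans _ (fun n => del n i0)).
  have := sim_dominated_sym (del_sim i0); rewrite mu1 => -[C C0 CP].
  by exists C => // n; have := CP n; rewrite powRr1// ltW.
exists 1 => // n; rewrite mul1r.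
apply: le_trans (bound_ge_term i0 (l0 n) (fun i => ltW (sim_powR_gt0 n i))).
by rewrite lerDr addr_ge0 ?invr_ge0 ?(mulr_ge0 _ (sqr_ge0 _))// ltW.
Qed.

Hypothesis lam_gt0 : forall n i, 0 < lam n i.
Hypothesis lam_sim : forall i,
  sim (fun n => lam n i) (fun n => del n i `^ (- (2 - (mu i)^-1))).

Let mu_gt0 i : 0 < mu i. Proof. exact: lt_le_trans (mu_ge1 i). Qed.

Let mu_inv_le1 i : (mu i)^-1 <= 1.
Proof. by rewrite invf_le1. Qed.

(** The exponents multiply: [mu_i (2 - 1/mu_i) = 2 mu_i - 1], and this is
    nonnegative because [mu_i >= 1], which makes the power monotone. *)
Lemma inv_weight_dominated i :
  dominated (fun n => (lam n i)^-1) (fun n => delta n `^ (2 * mu i - 1)).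
Proof.
pose a := 2 - (mu i)^-1.
apply: (@dominated_trans _ (fun n => del n i `^ a)).
  have := dominated_inv (fun n => powR_gt0 _ (sim_powR_gt0 n i))
    (fun n => lam_gt0 n i) (sim_dominated_sym (lam_sim i)).
  by move=> [C C0 CP]; exists C => // n; have := CP n; rewrite powRN invrK.
have a0 : 0 <= a by have := mu_inv_le1 i; rewrite /a; lra.
have := dominated_powR (fun n => ltW (sim_powR_gt0 n i))
  (fun n => powR_ge0 _ _) a0 (sim_dominated (del_sim i)).
move=> [C C0 CP]; exists C => // n; have := CP n; rewrite -powRrM.
by rewrite /a mulrBr divff ?gt_eqF// (mulrC (mu i)).
Qed.

(** The weight [lam_i ~ del_i^-(2 - 1/mu_i)] turns [del_i^2] into
    [del_i^(1/mu_i)], undoing the exponent in [del_i ~ delta^mu_i]; hence the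
    penalty is of the same order in every component. *)
Lemma weighted_noise_dominated i :
  dominated (fun n => lam n i * del n i ^+ 2) delta.
Proof.
apply: (@dominated_trans _ (fun n => del n i `^ (mu i)^-1)).
  have := dominatedM (fun n => ltW (lam_gt0 n i)) (fun n => sqr_ge0 (del n i))
    (sim_dominated (lam_sim i)) (dominated_refl (fun n => del n i ^+ 2)).
  move=> [C C0 CP]; exists C => // n; rewrite (le_trans (CP n))//.
  have d0 := sim_powR_gt0 n i.
  rewrite -powR_mulrn ?(ltW d0)// -powRD; last first.
    by rewrite (gt_eqF d0) implybT.
  by rewrite opprB subrK.
have mi0 : 0 <= (mu i)^-1 by rewrite invr_ge0 ltW.
have := dominated_powR (fun n => ltW (sim_powR_gt0 n i))
  (fun n => powR_ge0 _ _) mi0 (sim_dominated (del_sim i)).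
move=> [C C0 CP]; exists C => // n; have := CP n.
by rewrite -powRrM divff ?gt_eqF// powRr1// ltW.
Qed.

Lemma bound_dominated : delta @ \oo --> (0 : R) ->
  dominated (bound lam del) delta.
Proof.
move=> /cvg_dominated1 delta1.
apply: dominated_sum => [n|i]; first exact: ltW.
apply: dominatedD; first apply: dominatedD.
- apply: dominated_trans (inv_weight_dominated i) _.
  by apply: dominated_powR_ge1 => //; have := mu_ge1 i; lra.
- exact: weighted_noise_dominated.
- apply: dominated_trans (sim_dominated (del_sim i)) _.
  exact: dominated_powR_ge1.
Qed.

(** [delta^(2 mu_j - 1)] from the inverse weight, times [delta] from the bound. *)
Lemma residual_bound_dominated j : delta @ \oo --> (0 : R) ->
  dominated (fun n => (lam n j)^-1 * bound lam del n)
            (fun n => delta n `^ (2 * mu j)).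
Proof.
move=> delta0.
have inv0 n : 0 <= (lam n j)^-1 by rewrite invr_ge0 ltW.
have bound0 n : 0 <= bound lam del n.
  apply: le_trans (penalty_le_bound (lam_gt0 n) _) => [|i].
    by rewrite sumr_ge0// => i _; rewrite mulr_ge0 ?sqr_ge0// ltW.
  exact: ltW (sim_powR_gt0 n i).
have [C C0 CP] := dominatedM inv0 bound0 (inv_weight_dominated j)
  (bound_dominated delta0).
exists C => // n; rewrite (le_trans (CP n))//.
have delta_neq0 : delta n != 0 by rewrite gt_eqF.
rewrite powRB; last by rewrite delta_neq0 implybT.
by rewrite powRr1 ?divfK// ltW.
Qed.

End ParameterChoice.

(** * Convergence rates and optimality *)

Theorem corollary3p6 (R : realType) (X : completeNormedModType R) (N : nat)
  (Y : 'I_N -> normedModType R) (Reg : X -> \bar R)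
  (D : 'I_N -> set X) (T : forall i, X -> Y i)
  (tauX : topology_on X) (tauY : forall i, topology_on (Y i))
  (Reg_ge0 : forall u, (0 <= Reg u)%E)
  (Reg_proper : exists2 u, domT D u & (Reg u < +oo)%E)
  (tauX_hausdorff : hausdorff_space (top_space tauX))
  (tauY_hausdorff : forall i, hausdorff_space (top_space (tauY i)))
  (assN : assumptionN Reg D T tauX tauY)
  (f : nat -> forall i, Y i) (fdag : forall i, Y i)
  (noise_to0 : forall i, (fun n => noise fdag f n i) @ \oo --> (0 : R))
  (delta : nat -> R) (mu : 'I_N -> R)
  (delta_gt0 : forall n, 0 < delta n)
  (delta_to0 : delta @ \oo --> (0 : R))
  (mu_ge1 : forall i, 1 <= mu i)
  (mu_eq1 : exists i0, mu i0 = 1)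
  (noise_sim : forall i,
     sim (fun n => noise fdag f n i) (fun n => delta n `^ mu i))
  (lam : nat -> 'I_N -> R)
  (lam_gt0 : forall n i, 0 < lam n i)
  (lam_sim : forall i,
     sim (fun n => lam n i)
         (fun n => noise fdag f n i `^ (- (2 - (mu i)^-1))))
  (u : nat -> X) (udag : X)
  (u_sol : forall n, J_solution Reg D T (lam n) (f n) (u n))
  (udag_sol : R_minimizing_solution Reg D T fdag udag) :
  [/\ exists2 C : R, 0 < C &
        \forall n \near \oo, (Reg (u n) <= Reg udag + (C * delta n)%:E)%E,
      forall (xi : {linear X -> R^o}) (beta1 beta2 : R),
        subgradient Reg udag xi -> 0 < beta1 < 1 -> 0 < beta2 ->
        source_condition Reg D T fdag udag xi beta1 beta2 ->
        [/\ isO (fun n => bregman Reg xi (u n) udag) delta,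
            forall j, isO (fun n => (`|T j (u n) - f n j| ^+ 2)%:E)
                          (fun n => delta n `^ (2 * mu j)),
            isO (fun n => bregman Reg xi (u n) udag)
                (bound lam (noise fdag f))
          & forall j, isO (fun n => (`|T j (u n) - f n j| ^+ 2)%:E)
              (fun n => (lam n j)^-1 * bound lam (noise fdag f) n)],
      isO (fun n => (bound lam (noise fdag f) n)%:E) delta /\
      (forall j, isO
         (fun n => ((lam n j)^-1 * bound lam (noise fdag f) n)%:E)
         (fun n => delta n `^ (2 * mu j)))
    & forall eps : 'I_N -> R, (forall i, 0 < eps i < 2) ->
        let lam' := fun n i => noise fdag f n i `^ (- (2 - eps i)) in
        exists2 c : R, 0 < c & forall n,
          c * delta n <= bound lam' (noise fdag f) n /\
          forall j, c * delta n `^ (2 * mu j)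
                    <= (lam' n j)^-1 * bound lam' (noise fdag f) n].
Proof.
have noise_ge0 n i : 0 <= noise fdag f n i by exact: normr_ge0.
have boundO : dominated (bound lam (noise fdag f)) delta.
  exact: (bound_dominated delta_gt0 mu_ge1 noise_sim lam_gt0 lam_sim delta_to0).
have resO j : dominated (fun n => (lam n j)^-1 * bound lam (noise fdag f) n)
    (fun n => delta n `^ (2 * mu j)).
  exact: (residual_bound_dominated delta_gt0 mu_ge1 noise_sim lam_gt0 lam_sim j
    delta_to0).
split.
- have [C C0 CP] := boundO; exists C => //; apply: nearW => n.
  apply: le_trans (J_solution_Reg_le (lam_gt0 n) (u_sol n) udag_sol) _.
  rewrite leeD2l// lee_fin; apply: le_trans (CP n).
  exact: (penalty_le_bound (lam_gt0 n) (noise_ge0 n)).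
- move=> xi b1 b2 xi_sub /andP[b1_gt0 b1_lt1] b2_gt0 [eps eps_gt0 src].
  pose K := 1 + b2 + b2 ^+ 2.
  have K_gt0 : 0 < K by rewrite /K; nra.
  have b1'_gt0 : 0 < 1 - b1 by lra.
  have est : \forall n \near \oo, exists2 d : R,
      bregman Reg xi (u n) udag = d%:E &
      0 <= d /\ (1 - b1) * d +
        2^-1 * \sum_(i < N) lam n i * `|T i (u n) - f n i| ^+ 2 <=
        K * bound lam (noise fdag f) n.
    have half_gt0 : 0 < 2^-1 :> R by lra.
    have eps2_gt0 : 0 < eps / 2 by lra.
    have := dominated_near_le eps2_gt0 delta_to0 boundO.
    have := dominated_near_le half_gt0 delta_to0 boundO.
    apply: filterS2 => n small_half small_eps.
    have lam2 i : 2 <= lam n i.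
      have := bound_ge_term i (lam_gt0 n) (noise_ge0 n).
      have := noise_ge0 n i.
      have : 0 <= lam n i * noise fdag f n i ^+ 2.
        by rewrite mulr_ge0 ?sqr_ge0// ltW.
      rewrite -(invrK (lam n i)) => p q r.
      rewrite -[X in X <= _]invrK lef_pV2 ?posrE ?invr_gt0//.
      lra.
    apply: (source_condition_estimate Reg_ge0 (lam_gt0 n) (u_sol n) udag_sol
      xi_sub b2_gt0).
    apply: src; first by case: (u_sol n).
    apply: le_trans (J_solution_sublevel (u_sol n) udag_sol lam2) _.
    rewrite leeD2l// lee_fin.
    have := penalty_le_bound (lam_gt0 n) (noise_ge0 n); rewrite /noise.
    move: small_eps; rewrite /noise; lra.
  have pen_ge0 n j : 0 <= lam n j * `|T j (u n) - f n j| ^+ 2.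
    by rewrite mulr_ge0 ?sqr_ge0// ltW.
  have bregO : isO (fun n => bregman Reg xi (u n) udag)
      (bound lam (noise fdag f)).
    exists (K / (1 - b1)); first exact: divr_gt0.
    apply: filterS est => n [d -> [_ dle]].
    rewrite lee_fin mulrAC ler_pdivlMr// mulrC.
    by apply: le_trans dle; rewrite lerDl mulr_ge0// sumr_ge0.
  have residO j : isO (fun n => (`|T j (u n) - f n j| ^+ 2)%:E)
      (fun n => (lam n j)^-1 * bound lam (noise fdag f) n).
    exists (2 * K); first by rewrite mulr_gt0.
    apply: filterS est => n [d _ [d0 dle]].
    rewrite lee_fin mulrCA ler_pdivlMl//.
    have : lam n j * `|T j (u n) - f n j| ^+ 2 <=
        \sum_(i < N) lam n i * `|T i (u n) - f n i| ^+ 2.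
      by rewrite (bigD1 j)//= lerDl sumr_ge0.
    have : 0 <= (1 - b1) * d by rewrite mulr_ge0// ltW.
    lra.
  split => //; first exact: isO_dominated bregO boundO.
  by move=> j; exact: isO_dominated (residO j) (resO j).
- by split=> [|j]; exact: dominated_isO.
- move=> eps _ lam'; have [i0 mu1] := mu_eq1.
  have lam'_gt0 n i : 0 < lam' n i.
    by rewrite powR_gt0// (sim_powR_gt0 delta_gt0 noise_sim).
  have [C0 C0_gt0 C0P] := delta_dominated_bound delta_gt0 noise_sim mu1 lam'_gt0.
  have /choice[C CP] : forall j, exists C : R, 0 < C /\ forall n,
      delta n `^ (2 * mu j) <= C * ((lam' n j)^-1 * bound lam' (noise fdag f) n).
    move=> j; have [C ? ?] :=
      powR_dominated_residual_bound delta_gt0 noise_sim j lam'_gt0.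
    by exists C.
  (* the sum of the constants serves all components at once *)
  have sum_ge0 : 0 <= \sum_(j < N) C j.
    by rewrite sumr_ge0// => j _; rewrite ltW// (CP j).1.
  have S_gt0 : 0 < C0 + \sum_(j < N) C j by rewrite ltr_pwDl.
  exists (C0 + \sum_(j < N) C j)^-1; first by rewrite invr_gt0.
  have bound_ge0 n : 0 <= bound lam' (noise fdag f) n.
    apply: le_trans (penalty_le_bound (lam'_gt0 n) (noise_ge0 n)).
    by rewrite sumr_ge0// => i _; rewrite mulr_ge0 ?sqr_ge0// ltW.
  move=> n; split=> [|j]; rewrite ler_pdivrMl//.
    by apply: le_trans (C0P n) _; rewrite ler_wpM2r// lerDl.
  apply: le_trans ((CP j).2 n) _; rewrite ler_wpM2r//.
    by rewrite mulr_ge0// invr_ge0 ltW.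
  rewrite (bigD1 j)//= addrCA lerDl addr_ge0 ?(ltW C0_gt0)// sumr_ge0// => k _.
  by rewrite ltW// (CP k).1.
Qed.
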